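(* Let $a<b$ and $\alpha,\beta$ be real numbers. Let $\phi:\mathbb R\to\mathbb R$ satisfy $$\alpha v^2\le v\,\phi(v)\le\beta v^2\quad\text{for all }v\in\mathbb R,$$ and suppose $\Delta:\mathbf L_{e,[a,b]}\to\mathbf L_{e,[a,b]}$ is the operator $(\Delta\mathbf v)(s,t)=\phi(\mathbf v(s,t))$ for all $s\in[a,b]$, $t>0$. Then $\Delta$ satisfies the hard IQC defined by $\Psi=I$ and $$\mathcal K=\begin{bmatrix}\beta I&-I\\-\alpha I&I\end{bmatrix}^*\begin{bmatrix}0&\mathcal R\\ \mathcal R&0\end{bmatrix}\begin{bmatrix}\beta I&-I\\-\alpha I&I\end{bmatrix}=\begin{bmatrix}-\beta\mathcal R\alpha-\alpha\mathcal R\beta&\beta\mathcal R+\alpha\mathcal R\\ \mathcal R\beta+\mathcal R\alpha&-2\mathcal R\end{bmatrix}$$ for any operator $\mathcal R$ on $L_2[a,b]$ of the form $(\mathcal R\mathbf x)(s)=R_0(s)\mathbf x(s)$ with $R_0:[a,b]\to\mathbb R$ a bounded function satisfying $R_0(s)\ge0$.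
   Context: $\mathbf L_{e,[a,b]}$ denotes here the space of functions $\mathbf u:[0,\infty)\to L_2[a,b]$ (real scalar-valued $L_2$) with $\int_0^T\|\mathbf u(t)\|_{L_2}^2dt<\infty$ for all $T\ge0$; write $\mathbf u(s,t)$ for $(\mathbf u(t))(s)$. For square-integrable functions from $[0,\infty)$ to a Hilbert space $\mathbf H$, $\langle\mathbf u,\mathbf v\rangle_{\mathbf L}=\int_0^\infty\langle\mathbf u(t),\mathbf v(t)\rangle_{\mathbf H}dt$. $(P_\tau\mathbf y)(t)=\mathbf y(t)$ for $0\le t\le\tau$ and $0$ otherwise; for a bounded linear operator $\mathcal K$, $(M_{\mathcal K}\mathbf w)(t):=\mathcal K\mathbf w(t)$. $I$ is the identity operator and $^*$ the Hilbert space adjoint. Functions such as $\phi$ and $R_0$ are measurable. Hard IQC. $\Delta:\mathbf L_{e,[a,b]}\to\mathbf L_{e,[a,b]}$ satisfies the hard IQC defined by an operator $\Psi$ on the space of pairs $\begin{bmatrix}\mathbf v\\ \mathbf w\end{bmatrix}$, $\mathbf v,\mathbf w\in\mathbf L_{e,[a,b]}$, and a bounded linear operator $\mathcal K$ on $L_2[a,b]\times L_2[a,b]$, if for all $T>0$ and all $\mathbf v\in\mathbf L_{e,[a,b]}$, $$\left\langle P_T\Psi\begin{bmatrix}\mathbf v\\ \Delta\mathbf v\end{bmatrix},P_TM_{\mathcal K}\Psi\begin{bmatrix}\mathbf v\\ \Delta\mathbf v\end{bmatrix}\right\rangle_{\mathbf L}\ge0 .$$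
   Formalization: The formal statement adds the hypothesis φ(0)=0; without it the claim is false, since the sector bound does not constrain φ(0), and v=0 with R_0=1 gives −2φ(0)²(b−a)T<0 whenever φ(0)≠0. *)

(* Defs.v *)
From HB Require Import structures.
From mathcomp Require Import all_boot all_order all_algebra.
From mathcomp Require Import all_classical all_reals all_analysis.
From mathcomp Require Import measurable_realfun ess_sup_inf.

Set Implicit Arguments.
Unset Strict Implicit.
Unset Printing Implicit Defensive.
Import Order.TTheory GRing.Theory Num.Theory.
Import numFieldNormedType.Exports.
Local Open Scope classical_set_scope.
Local Open Scope ring_scope.

(* Real inner product spaces; completeness plays no role below. *)
HB.mixin Record Lmodule_isInnerProduct (R : realType) H & GRing.Lmodule R H := {
  hdot : H -> H -> R ;
  hdotC : forall x y, hdot x y = hdot y x ;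
  hdotPl : forall c x y z, hdot (c *: x + y) z = c * hdot x z + hdot y z ;
  hdot_ge0 : forall x, 0 <= hdot x x ;
  hdot_eq0 : forall x, hdot x x = 0 -> x = 0 }.

#[short(type=innerProductType)]
HB.structure Definition InnerProduct (R : realType) :=
  {H of GRing.Lmodule R H & Lmodule_isInnerProduct R H}.

Definition hnorm (R : realType) (H : innerProductType R) (x : H) : R :=
  Num.sqrt (hdot x x).

Definition bounded_linear (R : realType) (H : innerProductType R)
    (K : H -> H) : Prop :=
  linear K /\ exists M : R, forall x, hnorm (K x) <= M * hnorm x.

Definition is_adjoint (R : realType) (H : innerProductType R)
    (A B : H -> H) : Prop :=
  forall x y, hdot (A x) y = hdot x (B y).

(* The adjoint is unique when it exists; [adjoint A] is the zero map when it
   does not. *)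
Definition adjoint (R : realType) (H : innerProductType R) (A : H -> H) :
    H -> H :=
  xget (fun=> 0) [set B | is_adjoint A B].

Section prod_inner_product.
Context (R : realType) (H1 H2 : innerProductType R).

Let pdot (x y : H1 * H2) : R := hdot x.1 y.1 + hdot x.2 y.2.

Let pdotC x y : pdot x y = pdot y x.
Proof. by rewrite /pdot hdotC [X in _ + X]hdotC. Qed.

Let pdotPl c x y z : pdot (c *: x + y) z = c * pdot x z + pdot y z.
Proof. by rewrite /pdot !hdotPl mulrDr addrACA. Qed.

Let pdot_ge0 x : 0 <= pdot x x.
Proof. by rewrite addr_ge0// hdot_ge0. Qed.

Let pdot_eq0 x : pdot x x = 0 -> x = 0.
Proof.
move/eqP; rewrite paddr_eq0 ?hdot_ge0// => /andP[/eqP/hdot_eq0 x1 /eqP/hdot_eq0].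
by case: x x1 => ? ? /= -> ->.
Qed.

HB.instance Definition _ := Lmodule_isInnerProduct.Build R (H1 * H2)%type
  pdotC pdotPl pdot_ge0 pdot_eq0.

End prod_inner_product.

Definition block_op (V : zmodType) (A B C D : V -> V) (x : V * V) : V * V :=
  (A x.1 + B x.2, C x.1 + D x.2).

(* [LspaceType mu p1] comes without operations; they are obtained here from those
   of [LfunType mu p1] by passing to almost-everywhere classes. *)
Section Lspace_lmodType.
Context d (T : measurableType d) (R : realType).
Variables (mu : {measure set T -> \bar R}) (p : \bar R) (p1 : (1 <= p)%E).

HB.instance Definition _ := gen_eqMixin (LspaceType mu p1).
HB.instance Definition _ := gen_choiceMixin (LspaceType mu p1).

Local Open Scope quotient_scope.
Implicit Types (f g : LfunType mu p1) (x y z : LspaceType mu p1).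

Let ae_eq_Lnorm (h k : T -> R) : measurable_fun [set: T] h ->
  measurable_fun [set: T] k -> h = k %[ae mu] ->
  'N[mu]_p[EFin \o h]%E = 'N[mu]_p[EFin \o k]%E.
Proof.
move=> mh mk hk; rewrite unlock; case: p p1 => [r _|_|//].
- congr poweR; apply: ge0_ae_eq_integral => //.
  + apply/measurable_EFinP; apply: (measurableT_comp (measurable_powR _)).
    exact: measurableT_comp.
  + apply/measurable_EFinP; apply: (measurableT_comp (measurable_powR _)).
    exact: measurableT_comp.
  + by move=> t _; rewrite lee_fin powR_ge0.
  + by move=> t _; rewrite lee_fin powR_ge0.
  + by apply: filterS hk => t /(_ I) /= ->.
- case: ifPn => // _; apply: eq_ess_sup.
  by apply: filterS hk => t /(_ I) /= ->.
Qed.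

(* [LspaceType] is a quotient of functions into [measurableTypeR R], whereas
   [LfunType] has codomain [R]; the two sigma-algebras coincide. *)
Let mfunR (h : {mfun T >-> R}) : {mfun T >-> measurableTypeR R} :=
  HB.pack (h : T -> measurableTypeR R)
    (@isMeasurableFun.Build _ _ T (measurableTypeR R) h
      (@measurable_funPT _ _ _ _ h)).

Let cls (h : {mfun T >-> R}) : {mfun_ mu, T >-> measurableTypeR R} :=
  \pi_{mfun_ mu, T >-> measurableTypeR R} (mfunR h).

Let clsK (h : {mfun T >-> R}) : cls h = h %[ae mu].
Proof. by have /eqmodP/asboolP := reprK (cls h). Qed.

Let cls_finite f : finite_norm mu p (cls f).
Proof.
have mf : measurable_fun [set: T] (cls f : T -> R).
  exact: (@measurable_funPT _ _ _ _ (repr (cls f))).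
rewrite /finite_norm (ae_eq_Lnorm mf _ (clsK f))//.
exact: Lfunction_finite.
Qed.

Definition Lclass f : LspaceType mu p1 :=
  HB.pack (cls f) (isFinLebesgue.Build _ _ _ _ _ p1 _ (cls_finite f)).

Let Lrepr_mem x : (x : T -> R) \in Lfun mu p.
Proof.
apply/andP; split; rewrite inE/=.
  exact: (@measurable_funPT _ _ _ _ (repr (x : {mfun_ mu, T >-> _}))).
exact: (@Lebesgue_finite _ _ _ _ _ p1 x).
Qed.

Definition Lrepr x : LfunType mu p1 := Lfun_Sub p1 (Lrepr_mem x).

Lemma LclassK f : Lclass f = f %[ae mu].
Proof. exact: clsK. Qed.

Lemma Lspace_ext x y : (x = y %[ae mu]) -> x = y.
Proof.
move=> xy.
have : (x : {mfun_ mu, T >-> measurableTypeR R}) = y.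
  by rewrite -[LHS]reprK -[RHS]reprK; apply/eqmodP/asboolP.
case: x y {xy} => [x [[xp]]] [y [[yp]]] /= xy.
by subst y; rewrite (Prop_irrelevance xp yp).
Qed.

Definition Lspace0 : LspaceType mu p1 := Lclass 0.
Definition Lspace_opp x := Lclass (- Lrepr x).
Definition Lspace_add x y := Lclass (Lrepr x + Lrepr y).
Definition Lspace_scale (c : R) x := Lclass (c *: Lrepr x).

Let ae_add x y : Lspace_add x y = (fun t => x t + y t) %[ae mu].
Proof. exact: LclassK. Qed.

Let ae_opp x : Lspace_opp x = (fun t => - x t) %[ae mu].
Proof. exact: LclassK. Qed.

Let ae_scale c x : Lspace_scale c x = (fun t => c * x t) %[ae mu].
Proof. exact: LclassK. Qed.

Let ae_zero : Lspace0 = (fun=> 0) %[ae mu].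
Proof. exact: LclassK. Qed.

Let addC : commutative Lspace_add.
Proof.
move=> x y; apply: Lspace_ext.
apply: filterS (filterI (ae_add x y) (ae_add y x)).
by move=> t [/(_ I) -> /(_ I) ->] _; rewrite addrC.
Qed.

Let addA : associative Lspace_add.
Proof.
move=> x y z; apply: Lspace_ext; apply: filterS (filterI (ae_add x (Lspace_add y z))
  (filterI (ae_add (Lspace_add x y) z) (filterI (ae_add x y) (ae_add y z)))).
by move=> t [/(_ I) -> [/(_ I) -> [/(_ I) -> /(_ I) ->]]] _; rewrite addrA.
Qed.

Let add0 : left_id Lspace0 Lspace_add.
Proof.
move=> x; apply: Lspace_ext.
apply: filterS (filterI (ae_add Lspace0 x) ae_zero).
by move=> t [/(_ I) -> /(_ I) ->] _; rewrite add0r.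
Qed.

Let addN : left_inverse Lspace0 Lspace_opp Lspace_add.
Proof.
move=> x; apply: Lspace_ext.
apply: filterS (filterI (ae_add (Lspace_opp x) x)
  (filterI (ae_opp x) ae_zero)).
by move=> t [/(_ I) -> [/(_ I) -> /(_ I) ->]] _; rewrite addNr.
Qed.

HB.instance Definition _ :=
  GRing.isZmodule.Build (LspaceType mu p1) addA addC add0 addN.

Let scaleA a b x : Lspace_scale a (Lspace_scale b x) = Lspace_scale (a * b) x.
Proof.
apply: Lspace_ext; apply: filterS (filterI (ae_scale a (Lspace_scale b x))
  (filterI (ae_scale b x) (ae_scale (a * b) x))).
by move=> t [/(_ I) -> [/(_ I) -> /(_ I) ->]] _; rewrite mulrA.
Qed.

Let scale1 : left_id 1 Lspace_scale.
Proof.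
move=> x; apply: Lspace_ext; apply: filterS (ae_scale 1 x).
by move=> t /(_ I) -> _; rewrite mul1r.
Qed.

Let scaleDr : right_distributive Lspace_scale +%R.
Proof.
move=> a x y; apply: Lspace_ext; apply: filterS (filterI (ae_scale a (x + y)) (filterI (ae_add x y)
  (filterI (ae_add (Lspace_scale a x) (Lspace_scale a y))
    (filterI (ae_scale a x) (ae_scale a y))))).
move=> t [/(_ I) -> [/(_ I) -> [/(_ I) -> [/(_ I) -> /(_ I) ->]]]] _.
by rewrite mulrDr.
Qed.

Let scaleDl x : {morph Lspace_scale^~ x : a b / a + b}.
Proof.
move=> a b; apply: Lspace_ext; apply: filterS (filterI (ae_scale (a + b) x)
  (filterI (ae_add (Lspace_scale a x) (Lspace_scale b x))
    (filterI (ae_scale a x) (ae_scale b x)))).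
by move=> t [/(_ I) -> [/(_ I) -> [/(_ I) -> /(_ I) ->]]] _; rewrite mulrDl.
Qed.

HB.instance Definition _ := GRing.Zmodule_isLmodule.Build R (LspaceType mu p1)
  scaleA scale1 scaleDr scaleDl.

Lemma Lspace0E : (0 : LspaceType mu p1) = (fun=> 0) %[ae mu].
Proof. exact: ae_zero. Qed.

Lemma LspaceDE x y : x + y = (fun t => x t + y t) %[ae mu].
Proof. exact: ae_add. Qed.

Lemma LspaceNE x : - x = (fun t => - x t) %[ae mu].
Proof. exact: ae_opp. Qed.

Lemma LspaceZE c x : c *: x = (fun t => c * x t) %[ae mu].
Proof. exact: ae_scale. Qed.

End Lspace_lmodType.

Section L2_inner_product.
Context d (T : measurableType d) (R : realType).
Variable mu : {measure set T -> \bar R}.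
Implicit Types x y z : LspaceType2 mu.

Definition L2dot x y : R := (\int[mu]_t (x t * y t))%R.

Let L2mul_integrable x y : mu.-integrable setT (EFin \o (fun t => x t * y t)).
Proof.
by apply/Lfun1_integrable/Lfun2_mul_Lfun1; [exact: (LfunP (Lrepr x))|
  exact: (LfunP (Lrepr y))].
Qed.

Let L2dotC x y : L2dot x y = L2dot y x.
Proof. by apply: eq_Rintegral => t _; rewrite mulrC. Qed.

Let measurable_L2mul x y : measurable_fun setT (fun t => x t * y t).
Proof. by have /measurable_int/measurable_EFinP := L2mul_integrable x y. Qed.

Let L2dotPl c x y z : L2dot (c *: x + y) z = c * L2dot x z + L2dot y z.
Proof.
rewrite /L2dot -RintegralZl// -RintegralD//; 
  last exact: (integrableZl measurableT c (L2mul_integrable x z)).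
rewrite /Rintegral; congr fine; apply: ae_eq_integral => //.
- exact/measurable_EFinP.
- apply/measurable_EFinP; apply: measurable_funD => //.
  exact: measurable_funM.
- apply: filterS (filterI (LspaceDE (c *: x) y) (LspaceZE c x)) => t.
  by move=> [/(_ I) -> /(_ I) ->] _; rewrite mulrDl mulrA.
Qed.

Let L2dot_ge0 x : 0 <= L2dot x x.
Proof. by apply: Rintegral_ge0 => // t _; rewrite -expr2 sqr_ge0. Qed.

Let L2dot_eq0 x : L2dot x x = 0 -> x = 0.
Proof.
move=> xx0; apply: Lspace_ext.
have ixx : (\int[mu]_t (x t * x t)%:E = 0)%E.
  have fin := integrable_fin_num measurableT (L2mul_integrable x x).
  by rewrite -[LHS](fineK fin) -[0%E]/((0 : R)%:E) -xx0.
have : (fun t => (x t * x t)%:E) = cst 0%E %[ae mu].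
  have mxx : measurable_fun setT (fun t => (x t * x t)%:E).
    exact/measurable_EFinP.
  apply/(ae_eq_integral_abs mu measurableT mxx).
  rewrite -[RHS]ixx; apply: eq_integral => t _.
  by rewrite gee0_abs// lee_fin -expr2 sqr_ge0.
move=> xx; apply: filterS (filterI xx (Lspace0E mu (lee1n 2))) => t.
move=> [/(_ I)/= [/eqP] xt0 /(_ I) ->] _.
by move: xt0; rewrite mulf_eq0 orbb => /eqP.
Qed.

HB.instance Definition _ :=
  Lmodule_isInnerProduct.Build R (LspaceType mu (lee1n 2))
  L2dotC L2dotPl L2dot_ge0 L2dot_eq0.

End L2_inner_product.

Section extended_space.
Context (R : realType) (H : innerProductType R).
Local Notation lambda := (@lebesgue_measure R).

(* Bochner measurability on [D]: almost-everywhere limit of measurable maps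
   with finitely many values. *)
Definition strongly_measurable (D : set R) (u : R -> H) : Prop :=
  exists s : (R -> H)^nat,
    [/\ forall n, finite_set (range (s n)),
        forall n x, measurable (D `&` s n @^-1` [set x]) &
        {ae lambda, forall t, D t ->
          hnorm (s n t - u t) @[n --> \oo] --> (0 : R)}].

(* Functions on [0, +oo[ are encoded as functions on R vanishing on
   ]-oo, 0[. *)
Record Le_space := MkLe {
  Le_fun :> R -> H ;
  Le_fun_neg : forall t, t < 0 -> Le_fun t = 0 ;
  Le_measurable : strongly_measurable `[0, +oo[ Le_fun ;
  Le_finite : forall T, 0 <= T ->
    (\int[lambda]_(t in `[0%R, T]) (hnorm (Le_fun t) ^+ 2)%:E < +oo)%E }.

Definition truncation (tau : R) (y : R -> H) (t : R) : H :=
  if 0 <= t <= tau then y t else 0.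

(* The integral is taken in \bar R, so that no value is assigned by convention
   when it fails to be finite. *)
Definition dotL (u v : R -> H) : \bar R :=
  (\int[lambda]_(t in `[0%R, +oo[) (hdot (u t) (v t))%:E)%E.

End extended_space.

Definition multiplier (R : realType) (H : innerProductType R) (K : H -> H)
  (w : R -> H) (t : R) : H := K (w t).

Definition hard_IQC (R : realType) (H : innerProductType R)
    (Delta : Le_space H -> Le_space H)
    (Psi : Le_space H * Le_space H -> Le_space H * Le_space H)
    (K : H * H -> H * H) : Prop :=
  bounded_linear K /\
  forall (T : R) (v : Le_space H), 0 < T ->
    let y : R -> H * H :=
      fun t => ((Psi (v, Delta v)).1 t, (Psi (v, Delta v)).2 t) in
    (0 <= dotL (truncation T y) (truncation T (multiplier K y)))%E.

(* Elements are classes of functions on R modulo equality almost everywhere on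
   [a, b]; [x s], for [x : L2_itv a b], is the value at [s] of a representative
   of [x], and is meaningful only for almost every [s] in [a, b]. *)
Definition L2_itv (R : realType) (a b : R) : Type :=
  LspaceType2 (mrestr (@lebesgue_measure R) (measurable_itv `[a, b]%R)).

HB.instance Definition _ (R : realType) (a b : R) :=
  InnerProduct.copy (L2_itv a b)
    (LspaceType2 (mrestr (@lebesgue_measure R) (measurable_itv `[a, b]%R))).

Definition L2_fun (R : realType) (a b : R) (x : L2_itv a b) : R -> R :=
  x : LspaceType2 (mrestr (@lebesgue_measure R) (measurable_itv `[a, b]%R)).
Coercion L2_fun : L2_itv >-> Funclass.

(* Main.v *)
(* Write w = phi o v. By adjointness <y, B* N B y> = <B y, N B y>, which for
   y = (v, w) is <p, calR q> + <q, calR p> with p = beta v - w and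
   q = w - alpha v. The sector condition gives v^2 p q >= 0 pointwise, so p q >= 0
   where v <> 0; where v = 0, phi 0 = 0 makes p and q vanish. Multiplying by
   R0 >= 0 and integrating over s, then over t, gives the inequality. *)

Require Import Defs.
From HB Require Import structures.
From mathcomp Require Import all_boot all_order all_algebra.
From mathcomp Require Import all_classical all_reals all_analysis.
From mathcomp Require Import measurable_realfun ring lra.

Set Implicit Arguments.
Unset Strict Implicit.
Unset Printing Implicit Defensive.
Import Order.TTheory GRing.Theory Num.Theory.
Import numFieldNormedType.Exports.
Local Open Scope classical_set_scope.
Local Open Scope ring_scope.

(** * Inner products, adjoints and bounded operators *)

Section inner_product_lemmas.
Context (R : realType).
Implicit Types H : innerProductType R.

Lemma hdot0l H (y : H) : hdot 0 y = 0.
Proof.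
by have := hdotPl 1 0 0 y; rewrite scaler0 addr0 mul1r => /esym/eqP;
  rewrite -subr_eq0 addrK => /eqP.
Qed.

Lemma hdotDl H (x y z : H) : hdot (x + y) z = hdot x z + hdot y z.
Proof. by rewrite -[x in LHS]scale1r hdotPl mul1r. Qed.

Lemma hdotZl H c (x z : H) : hdot (c *: x) z = c * hdot x z.
Proof. by rewrite -[c *: x]addr0 hdotPl hdot0l addr0. Qed.

Lemma hdotNl H (x z : H) : hdot (- x) z = - hdot x z.
Proof. by rewrite -scaleN1r hdotZl mulN1r. Qed.

Lemma hdotDr H (x y z : H) : hdot x (y + z) = hdot x y + hdot x z.
Proof. by rewrite hdotC hdotDl !(hdotC x). Qed.

Lemma hdotZr H c (x z : H) : hdot x (c *: z) = c * hdot x z.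
Proof. by rewrite hdotC hdotZl hdotC. Qed.

Lemma hdotNr H (x z : H) : hdot x (- z) = - hdot x z.
Proof. by rewrite hdotC hdotNl hdotC. Qed.

Lemma hdot_inj H (x y : H) : (forall z, hdot z x = hdot z y) -> x = y.
Proof.
move=> xy; apply/eqP; rewrite -subr_eq0; apply/eqP/hdot_eq0.
by rewrite hdotDr hdotNr xy subrr.
Qed.

(** By nondegeneracy an operator has at most one adjoint, so exhibiting one pins down the value
    chosen by [xget]. *)
Lemma adjointE H (A B : H -> H) : is_adjoint A B -> adjoint A = B.
Proof.
move=> AB; have AA : is_adjoint A (adjoint A).
  by apply: (@xgetPex (H -> H) _ [set C | is_adjoint A C]); exists B.
by apply/funext => y; apply: hdot_inj => z; rewrite -AA AB.
Qed.

Lemma hdot_pair H1 H2 (x y : (H1 * H2)%type) :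
  hdot x y = hdot x.1 y.1 + hdot x.2 y.2.
Proof. by []. Qed.

Lemma is_adjoint_block H (A A' B B' C C' D D' : H -> H) :
  is_adjoint A A' -> is_adjoint B B' -> is_adjoint C C' -> is_adjoint D D' ->
  is_adjoint (block_op A B C D : H * H -> H * H) (block_op A' C' B' D').
Proof.
move=> AA BB CC DD x y; rewrite !hdot_pair /= !hdotDl !hdotDr AA BB CC DD.
by rewrite addrACA.
Qed.

(* Stands in for the triangle inequality of [hnorm], which would need
   Cauchy-Schwarz. *)
Lemma hdot_add_le H (x y : H) :
  hdot (x + y) (x + y) <= 2 * hdot x x + 2 * hdot y y.
Proof.
have := hdot_ge0 (x - y).
rewrite !hdotDl !hdotDr !hdotNl !hdotNr (hdotC y x); lra.
Qed.

(** The squared bound avoids square roots and combines with [hdot_add_le]. [M] becomes [M ^+ 2] one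
    way and [Num.sqrt M] the other. *)
Lemma bounded_linearP H (A : H -> H) : bounded_linear A <->
  linear A /\ exists2 M, 0 <= M & forall x, hdot (A x) (A x) <= M * hdot x x.
Proof.
split=> -[linA [M]].
  move=> AM; split => //; exists (M ^+ 2); first exact: sqr_ge0.
  move=> x; have := AM x; rewrite /hnorm => Ax.
  rewrite -(sqr_sqrtr (hdot_ge0 (A x))) -(sqr_sqrtr (hdot_ge0 x)) -exprMn.
  (* The sign of [M] is unknown, but [M * hnorm x] dominates a norm, so both sides may be
     squared. *)
  by rewrite lerXn2r// nnegrE ?sqrtr_ge0// (le_trans _ Ax)// sqrtr_ge0.
move=> M0 AM; split => //; exists (Num.sqrt M) => x.
by rewrite /hnorm -sqrtrM// ler_wsqrtr.
Qed.

Lemma bounded_linear0 H : bounded_linear (fun=> 0 : H).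
Proof.
apply/bounded_linearP; split; first by move=> c x y; rewrite scaler0 addr0.
by exists 0 => // x; rewrite hdot0l mul0r.
Qed.

Lemma bounded_linear_scale H c : bounded_linear (fun x : H => c *: x).
Proof.
apply/bounded_linearP; split.
  by move=> k x y; rewrite scalerDr !scalerA mulrC.
exists (c ^+ 2); first exact: sqr_ge0.
by move=> x; rewrite hdotZl hdotZr mulrA expr2.
Qed.

Lemma bounded_linear_comp H (A B : H -> H) :
  bounded_linear A -> bounded_linear B -> bounded_linear (A \o B).
Proof.
move=> /bounded_linearP[linA [M M0 AM]] /bounded_linearP[linB [N N0 BN]].
apply/bounded_linearP; split; first by move=> c x y /=; rewrite linB linA.
exists (M * N); first exact: mulr_ge0.
by move=> x /=; rewrite (le_trans (AM _))// -mulrA ler_wpM2l.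
Qed.

Lemma bounded_linear_block H (A B C D : H -> H) :
  bounded_linear A -> bounded_linear B -> bounded_linear C ->
  bounded_linear D -> bounded_linear (block_op A B C D : H * H -> H * H).
Proof.
move=> /bounded_linearP[linA [MA MA0 AM]] /bounded_linearP[linB [MB MB0 BM]].
move=> /bounded_linearP[linC [MC MC0 CM]] /bounded_linearP[linD [MD MD0 DM]].
apply/bounded_linearP; split.
  move=> c x y; congr pair => /=.
    by rewrite linA linB scalerDr addrACA.
  by rewrite linC linD scalerDr addrACA.
(* The 2 comes from [hdot_add_le] on each row. The rows need [MA + MC] on [x.1] and [MB + MD] on
   [x.2]; the four nonnegative products below pad both to the full sum. *)
exists (2 * (MA + MB + MC + MD)); first by rewrite mulr_ge0// !addr_ge0.
move=> x; rewrite !hdot_pair /=.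
have := hdot_add_le (A x.1) (B x.2); have := hdot_add_le (C x.1) (D x.2).
have := AM x.1; have := BM x.2; have := CM x.1; have := DM x.2.
have := mulr_ge0 MB0 (hdot_ge0 x.1); have := mulr_ge0 MA0 (hdot_ge0 x.2).
have := mulr_ge0 MD0 (hdot_ge0 x.1); have := mulr_ge0 MC0 (hdot_ge0 x.2).
lra.
Qed.

End inner_product_lemmas.

(** * The scalar sector inequality *)

(** For nonzero [x], multiplying by [x ^+ 2] turns the two factors into the gaps of the sector
    bound. At [x = 0] that bound says nothing about [y], hence the second hypothesis. *)
Lemma sector_mul_ge0 (R : realType) (alpha beta x y : R) :
  alpha * x ^+ 2 <= x * y <= beta * x ^+ 2 -> (x = 0 -> y = 0) ->
  0 <= (beta * x - y) * (y - alpha * x).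
Proof.
move=> /andP[lo hi]; have [->|x0 _] := eqVneq x 0.
  by move=> /(_ erefl) ->; rewrite !mulr0 subrr mul0r.
have x2 : 0 < x ^+ 2 by rewrite exprn_even_gt0.
rewrite -(pmulr_rge0 _ x2).
have -> : x ^+ 2 * ((beta * x - y) * (y - alpha * x)) =
    (beta * x ^+ 2 - x * y) * (x * y - alpha * x ^+ 2) by ring.
by rewrite mulr_ge0// subr_ge0.
Qed.

(** * Almost-everywhere calculus in the space of square-integrable functions on [a, b] *)

(** The measure underlying [L2_itv a b]: it lives on the whole line and is null outside [a, b]. *)
Definition lebesgue_on (R : realType) (a b : R) :
    {measure set (measurableTypeR R) -> \bar R} :=
  mrestr (@lebesgue_measure R) (measurable_itv `[a, b]%R).

(* The filter instance of the library is keyed on a measurable type as carrier,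
   whereas predicates on [L2_itv a b] are stated over [R]. *)
#[local] Instance lebesgue_on_ae_filter (R : realType) (a b : R) :
  @Filter R (nbhs (almost_everywhere (lebesgue_on a b))).
Proof. exact: (@ae_filter_ringOfSetsType _ _ _ (lebesgue_on a b)). Qed.

Section L2_itv_lemmas.
Context (R : realType) (a b : R).
Local Notation lambda := (@lebesgue_measure R).
Local Notation mu := (lebesgue_on a b).
Implicit Types x y z w : L2_itv a b.

Lemma ae_L2_itv (P : R -> Prop) :
  {ae lambda, forall s, a <= s <= b -> P s} -> {ae mu, forall s, P s}.
Proof.
(* The complement of [a, b] joins the exceptional set, at no cost for the restricted measure. *)
move=> [N [mN N0 PN]]; exists (N `|` ~` `[a, b]); split.
- by apply: measurableU => //; exact: measurableC.
- rewrite /= /mrestr setIUl setICl setU0.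
  apply: (@subset_measure0 _ _ _ lambda _ N) => //; exact: measurableI.
- move=> s /= nPs; have [sab|] := boolP (a <= s <= b).
    by left; apply: PN => /= /(_ sab).
  by right => /=; rewrite in_itv /=; exact/negP.
Qed.

Lemma L2_itv_ext x y : {ae mu, forall s, x s = y s} -> x = y.
Proof. by move=> xy; apply: Lspace_ext; apply: filterS xy => s + _. Qed.

Lemma L2_itvD x y : {ae mu, forall s, L2_fun (x + y) s = x s + y s}.
Proof. by apply: filterS (LspaceDE x y) => s /(_ I). Qed.

Lemma L2_itvN x : {ae mu, forall s, L2_fun (- x) s = - x s}.
Proof. by apply: filterS (LspaceNE x) => s /(_ I). Qed.

Lemma L2_itvZ c x : {ae mu, forall s, L2_fun (c *: x) s = c * x s}.
Proof. by apply: filterS (LspaceZE c x) => s /(_ I). Qed.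

Lemma L2_itv0 : {ae mu, forall s, L2_fun (0 : L2_itv a b) s = 0}.
Proof. by apply: filterS (Lspace0E mu (lee1n 2)) => s /(_ I). Qed.

Lemma L2_itv_integrable x y : mu.-integrable setT (fun s => (x s * y s)%:E).
Proof.
by apply/Lfun1_integrable/Lfun2_mul_Lfun1; [exact: (LfunP (Lrepr x))|
  exact: (LfunP (Lrepr y))].
Qed.

Lemma hdot_L2E x y : hdot x y = (\int[mu]_s (x s * y s))%R.
Proof. by []. Qed.

(** The difference [h] of the integrands is nonnegative only almost everywhere, so it is replaced
    under the integral by its absolute value, which is nonnegative everywhere. *)
Lemma le_hdot_L2 x y z w :
  {ae mu, forall s, x s * y s <= z s * w s} -> hdot x y <= hdot z w.
Proof.
move=> xyzw.
pose h s := z s * w s - x s * y s.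
have ih : mu.-integrable setT (EFin \o h).
  exact: (integrableB measurableT (L2_itv_integrable z w)
    (L2_itv_integrable x y)).
have mh := measurable_int _ ih.
rewrite -subr_ge0 !hdot_L2E -RintegralB//; try exact: L2_itv_integrable.
rewrite /Rintegral fine_ge0//.
rewrite (_ : (\int[mu]_s _ = \int[mu]_s `|h s|%:E)%E).
  by apply: integral_ge0 => s _; rewrite lee_fin.
apply: ae_eq_integral => //;
  first exact: (measurableT_comp (@abse_measurable R setT) mh).
by apply: filterS xyzw => s xyzw _; rewrite ger0_norm// subr_ge0.
Qed.

Lemma hdot_L2_ge0 x y : {ae mu, forall s, 0 <= x s * y s} -> 0 <= hdot x y.
Proof.
move=> xy; rewrite -(hdot0l (0 : L2_itv a b)); apply: le_hdot_L2.
by apply: filterS (filterI L2_itv0 xy) => s [-> ?]; rewrite mul0r.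
Qed.

Lemma bounded_linear_L2_mul (A : L2_itv a b -> L2_itv a b) (r : R -> R)
    (M : R) : (forall s, a <= s <= b -> `|r s| <= M) ->
  (forall x, {ae lambda, forall s, a <= s <= b -> A x s = r s * x s}) ->
  bounded_linear A.
Proof.
move=> rM Ar; have Amu x := ae_L2_itv (Ar x).
apply/bounded_linearP; split.
  move=> c x y; apply: L2_itv_ext.
  apply: filterS (filterI (Amu (c *: x + y)) (filterI (L2_itvD (c *: x) y)
    (filterI (L2_itvZ c x) (filterI (Amu x) (filterI (Amu y)
    (filterI (L2_itvD (c *: A x) (A y)) (L2_itvZ c (A x)))))))).
  move=> s [-> [-> [-> [Ax [Ay [-> ->]]]]]].
  by rewrite Ax Ay mulrDr mulrCA.
exists (M * M); first by rewrite -expr2 sqr_ge0.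
(* The bound is read as the inner product of [M *: x] with itself, so that integrands can be
   compared. *)
move=> x; rewrite -mulrA -hdotZr -hdotZl; apply: le_hdot_L2.
have rMmu : {ae mu, forall s, `|r s| <= M}.
  by apply: ae_L2_itv; apply: aeW => s /rM.
apply: filterS (filterI (Amu x) (filterI (L2_itvZ M x) rMmu)).
move=> s [-> [-> rsM]]; rewrite -!expr2 !exprMn ler_wpM2r ?sqr_ge0//.
(* Squaring needs [0 <= M], which the bound at this [s] supplies. *)
by rewrite -(real_normK (num_real (r s))) lerXn2r// nnegrE// (le_trans _ rsM).
Qed.

(** The integrand is [r] times the product of [x] and [y]; this is where the sign of [R0] enters. *)
Lemma hdot_L2_mul_ge0 (A : L2_itv a b -> L2_itv a b) (r : R -> R) x y :
  (forall s, a <= s <= b -> 0 <= r s) ->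
  (forall x, {ae lambda, forall s, a <= s <= b -> A x s = r s * x s}) ->
  {ae mu, forall s, 0 <= x s * y s} -> 0 <= hdot x (A y).
Proof.
move=> r0 Ar xy; apply: hdot_L2_ge0.
have r0mu : {ae mu, forall s, 0 <= r s}.
  by apply: ae_L2_itv; apply: aeW => s /r0.
apply: filterS (filterI r0mu (filterI (ae_L2_itv (Ar y)) xy)).
by move=> s [rs [-> xys]]; rewrite mulrCA mulr_ge0.
Qed.

(** Operations on classes are pointwise only up to null sets; off their union the scalar inequality
    applies. The factors have the shape of the two rows of [B]. *)
Lemma L2_itv_sector (alpha beta : R) (phi : R -> R) (v w : L2_itv a b) :
  (forall c, alpha * c ^+ 2 <= c * phi c <= beta * c ^+ 2) -> phi 0 = 0 ->
  {ae lambda, forall s, a <= s <= b -> w s = phi (v s)} ->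
  {ae mu, forall s,
    0 <= L2_fun (beta *: v - w) s * L2_fun (- (alpha *: v) + w) s}.
Proof.
move=> sector phi0 wv.
apply: filterS (filterI (ae_L2_itv wv) (filterI (L2_itvD (beta *: v) (- w))
  (filterI (L2_itvN w) (filterI (L2_itvZ beta v)
  (filterI (L2_itvD (- (alpha *: v)) w)
  (filterI (L2_itvN (alpha *: v)) (L2_itvZ alpha v))))))).
move=> s [ws [-> [-> [-> [-> [-> ->]]]]]]; rewrite ws [- _ + _]addrC.
by apply: sector_mul_ge0 => // ->.
Qed.

End L2_itv_lemmas.

(** * Integration over time *)

(* The negative part of the integrand is supported at the single point [0],
   hence is measurable with integral 0. *)
Lemma dotL_ge0 (R : realType) (H : innerProductType R) (u v : R -> H) :
  (forall t, 0 < t -> 0 <= hdot (u t) (v t)) -> (0 <= dotL u v)%E.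
Proof.
move=> uv; rewrite /dotL integralE.
rewrite [X in (_ - X)%E](_ : _ = 0%E).
  by rewrite sube0; apply: integral_ge0.
set f := fun t => (hdot (u t) (v t))%:E.
transitivity
  (\int[lebesgue_measure]_(t in `[0%R, +oo[) (f^\- \_ [set 0%R]) t)%E.
  apply: eq_integral => t; rewrite inE/= in_itv/= andbT le_eqVlt.
  move=> /predU1P[<-|t0]; first by rewrite patchE mem_set.
  rewrite patchE memNset /=; last by move=> /= tE; rewrite tE ltxx in t0.
  by rewrite /f funenegE; apply/max_idPr; rewrite leeNl oppe0 lee_fin uv.
rewrite -integral_mkcondr setIidr; last first.
  by move=> t /= ->; rewrite in_itv/= lexx.
apply: null_set_integral => //; first exact: measurable_fun_set1.
exact: lebesgue_measure_set1.
Qed.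

(** * The multiplier [K] and its quadratic constraint *)

(* The sector bound says nothing about [phi 0]; without [phi 0 = 0] the conclusion
   is false (take v = 0). *)
Theorem lemma13 (R : realType) (a b : R) (hab : a < b) (alpha beta : R)
    (phi : R -> R)
    (phi_meas : measurable_fun [set: R] phi)
    (phi_sector : forall v : R,
       alpha * v ^+ 2 <= v * phi v <= beta * v ^+ 2)
    (phi0 : phi 0 = 0)
    (Delta : Le_space (L2_itv a b) -> Le_space (L2_itv a b))
    (Delta_phi : forall (v : Le_space (L2_itv a b)) (t : R), 0 < t ->
       {ae lebesgue_measure, forall s : R, a <= s <= b ->
         (Delta v t) s = phi ((v t) s)})
    (calR : L2_itv a b -> L2_itv a b) (R0 : R -> R)
    (R0_meas : measurable_fun `[a, b] R0)
    (R0_bounded : exists M : R, forall s : R, a <= s <= b -> `|R0 s| <= M)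
    (R0_ge0 : forall s : R, a <= s <= b -> 0 <= R0 s)
    (calR_R0 : forall x : L2_itv a b,
       {ae lebesgue_measure, forall s : R, a <= s <= b ->
         (calR x) s = R0 s * x s}) :
  let B := block_op (fun x : L2_itv a b => beta *: x) (fun x => - x)
                    (fun x => - (alpha *: x))          (fun x => x) in
  let K := adjoint B \o block_op (fun _ => 0) calR calR (fun _ => 0) \o B in
  K = block_op
        (fun x => - (beta *: calR (alpha *: x)) - alpha *: calR (beta *: x))
        (fun x => beta *: calR x + alpha *: calR x)
        (fun x => calR (beta *: x) + calR (alpha *: x))
        (fun x => - (2%:R *: calR x))
  /\ hard_IQC Delta idfun K.
Proof.
move=> B K.
have [M R0M] := R0_bounded.
(* [calR] is given only by its almost-everywhere formula; linearity and boundedness are read off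
   from it. *)
have blR : bounded_linear calR := bounded_linear_L2_mul R0M calR_R0.
have [linR _] := blR.
have calRD x y : calR (x + y) = calR x + calR y.
  by rewrite -[x in LHS]scale1r linR scale1r.
have calR0 : calR 0 = 0 by apply: (addrI (calR 0)); rewrite -calRD !addr0.
have calRZ c x : calR (c *: x) = c *: calR x.
  by rewrite -[c *: x in LHS]addr0 linR calR0 addr0.
have calRN x : calR (- x) = - calR x by rewrite -scaleN1r calRZ scaleN1r.
(* The transposed block matrix; every entry is a real scaling, hence self-adjoint. *)
pose B' := block_op (fun x : L2_itv a b => beta *: x)
  (fun x => - (alpha *: x)) (fun x => - x) (fun x => x).
have BB' : is_adjoint B B'.
  apply: is_adjoint_block => x y; rewrite ?hdotNl ?hdotNr ?hdotZl ?hdotZr//.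
have adjB : adjoint B = B' := adjointE BB'.
have KE : K = B' \o block_op (fun _ => 0) calR calR (fun _ => 0) \o B.
  by rewrite /K adjB.
split.
  rewrite KE; apply/funext => -[x1 x2]; rewrite /B' /B /block_op /=.
  (* With all scalars pulled out of [calR], each row is an identity between combinations of
     [calR x1] and [calR x2]. *)
  rewrite !(calRD, calRN, calRZ, add0r, addr0); congr pair.
    rewrite !scalerDr !scalerN !scalerA (mulrC alpha beta).
    rewrite opprD opprK -!addrA; congr (_ + _).
    by rewrite addrCA.
  rewrite scaler_nat mulr2n opprD.
  by rewrite opprD opprK addrACA addrC [in LHS]addrC -addrA addrCA !addrA.
split.
  (* Identity and negation are also treated as scalings, by 1 and -1. *)
  have blZ := bounded_linear_scale (L2_itv a b).
  have blN c : bounded_linear (fun x : L2_itv a b => - (c *: x)).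
    rewrite (_ : (fun x => _) = *:%R (- c)) //.
    by apply/funext => x; rewrite scaleNr.
  have bl1 : bounded_linear (fun x : L2_itv a b => x).
    rewrite (_ : (fun x => x) = *:%R 1) //.
    by apply/funext => x; rewrite scale1r.
  have blN1 : bounded_linear (fun x : L2_itv a b => - x).
    rewrite (_ : (fun x => - x) = *:%R (- 1)) //.
    by apply/funext => x; rewrite scaleN1r.
  have bl0 := bounded_linear0 (L2_itv a b).
  rewrite KE.
  by do 2?[apply: bounded_linear_comp]; apply: bounded_linear_block.
(* Only [t > 0] remains, exactly where [Delta_phi] describes [Delta v]. *)
move=> T v T0; cbv zeta; apply: dotL_ge0 => t t0; rewrite /truncation.
case: ifPn => _; last by rewrite hdot0l.
(* Moving [B'] across leaves the symmetric sum of [calR] cross terms in the two rows of [B] applied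
   to the pair. *)
rewrite /multiplier KE /= -BB' hdot_pair /= !add0r !addr0.
have pq := L2_itv_sector phi_sector phi0 (Delta_phi v t t0).
apply: addr_ge0; apply: (hdot_L2_mul_ge0 R0_ge0 calR_R0) => //.
by apply: filterS pq => s; rewrite mulrC.
Qed.
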